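(* Let $Q$ be a probability measure on $\mathbb Z^{\ge0}$ and let $\tilde Q$ be the least concave majorant of $Q$. Then $Q\ll\tilde Q$, and $\tilde Q^a$, the absolutely continuous part of $\tilde Q$ with respect to $Q$, i.e. the subprobability with mass function $f_{\tilde Q^a}(n)=f_{\tilde Q}(n)\mathbf 1_{\{f_Q(n)>0\}}$, is the reverse information projection of $Q$ onto $\mathcal M$. Consequently, the supremum $$\sup_{E\in\mathcal M^\circ}\ \mathbb E_{X\sim Q}\log E(X)$$ is attained by the function $$E_Q^*(n)=\frac{f_Q(n)}{f_{\tilde Q}(n)},$$ where $0/0$ is understood as $0$.
   Context: $\mathbb Z^{\ge0}=\{0,1,2,\dots\}$; $f_P(n)=P(\{n\})$ and $F_P(n)=P((-\infty,n])$ denote the mass function and cumulative distribution function of $P$. $\mathcal M$ is the set of probability measures $P$ on $\mathbb Z^{\ge0}$ with $f_P(n)\ge f_P(n+1)$ for all $n\in\mathbb Z^{\ge0}$. The least concave majorant of $Q$ is the probability measure $\tilde Q$ on $\mathbb Z^{\ge0}$ whose CDF $F_{\tilde Q}$ is the smallest concave function majorizing $F_Q$, concavity being understood on $\{-1,0,1,2,\dots\}$ with $F_Q(-1)=F_{\tilde Q}(-1)=0$. For a set $\mathcal A$ of measures, the polar $\mathcal A^\circ$ is the set of functions $f:\mathbb Z^{\ge0}\to[0,\infty)$ with $\sup_{P\in\mathcal A}\int f\,dP\le1$, and the bipolar ${}^\circ(\mathcal A^\circ)$ is the set of ($\sigma$-finite) measures $P$ on $\mathbb Z^{\ge0}$ with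 $\sup_{f\in\mathcal A^\circ}\int f\,dP\le1$. For a class $\mathcal A$ of probabilities with $Q\ll\mathcal A$ (always true for $\mathcal A=\mathcal M$; it means that every set null under all $P\in\mathcal A$ is $Q$-null), the numeraire is the $Q$-a.s. unique, $Q$-a.s. positive $E^*\in\mathcal A^\circ$ such that $\mathbb E_{X\sim Q}\log\frac{E(X)}{E^*(X)}\in[-\infty,0]$ for all $E\in\mathcal A^\circ$, and the reverse information projection (RIPr) of $Q$ onto $\mathcal A$ is the measure $P^*$ defined by $dP^*/dQ=1/E^*$. Equivalently (Larsson, Ramdas and Ruf), $P^*$ is the unique measure in ${}^\circ(\mathcal A^\circ)$ that is mutually absolutely continuous with $Q$ and for which some version of $dQ/dP^*$ belongs to $\mathcal A^\circ$. Convention: $\mathbb E_{X\sim Q}\log g(X)=-\infty$ whenever $\mathbb E_{X\sim Q}(\log g(X))^-=\infty$. *)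

(* Defs.v *)
From HB Require Import structures.
From mathcomp Require Import all_boot all_order all_algebra.
From mathcomp Require Import all_classical all_reals all_analysis.
From mathcomp Require Import ring lra zify.

Set Implicit Arguments.
Unset Strict Implicit.
Unset Printing Implicit Defensive.

Import Order.TTheory GRing.Theory Num.Theory.
Import numFieldNormedType.Exports.

Local Open Scope classical_set_scope.
Local Open Scope ring_scope.
Local Open Scope ereal_scope.

(* The nonnegative integers are [nat] with its discrete sigma-algebra, so that
   every set is measurable and every function is measurable. *)

Section definitions.
Context (R : realType).

Definition mass (P : set nat -> \bar R) (n : nat) : R := fine (P [set n]).

(* The argument ranges over [int] so that the point -1 is available. *)
Definition cdfz (P : set nat -> \bar R) (z : int) : R :=
  fine (P [set n : nat | (n%:Z <= z)%R]).

Definition nonincreasing_class : set (probability nat R) :=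
  [set P | forall n, (mass P n.+1 <= mass P n)%R].

(* Concavity on {-1, 0, 1, ...}; the values of G below -1 are irrelevant. *)
Definition concave_from_m1 (G : int -> R) : Prop :=
  forall a b c : int, (-1 <= a)%R -> (a <= b)%R -> (b <= c)%R ->
  ((c - b)%:~R * G a + (b - a)%:~R * G c <= (c - a)%:~R * G b)%R.

Definition majorizes_from_m1 (G F : int -> R) : Prop :=
  forall z : int, (-1 <= z)%R -> (F z <= G z)%R.

(* By construction [cdfz Q (-1) = cdfz Qt (-1) = 0]; the competitors G are
   arbitrary concave majorants (in particular only G (-1) >= 0 is forced). *)
Definition is_least_concave_majorant (Q Qt : probability nat R) : Prop :=
  [/\ concave_from_m1 (cdfz Qt),
      majorizes_from_m1 (cdfz Qt) (cdfz Q) &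
      forall G, concave_from_m1 G -> majorizes_from_m1 G (cdfz Q) ->
        majorizes_from_m1 G (cdfz Qt)].

Definition polar (A : set (probability nat R)) : set (nat -> R) :=
  [set f | (forall n, (0 <= f n)%R) /\
           ereal_sup [set \int[P]_n (f n)%:E | P in A] <= 1].

(* [lne 0 = -oo], and the integral is the difference of the integrals of the
   positive and negative parts with [+oo - +oo = -oo]; hence the value is -oo
   as soon as the negative part has infinite integral. *)
Definition expected_log (Q : probability nat R) (g : nat -> R) : \bar R :=
  \int[Q]_n lne (g n)%:E.

(* [E n / E' n] is 0 where [E' n = 0]; this happens only on a Q-null set. *)
Definition is_numeraire (Q : probability nat R) (A : set (probability nat R))
    (E' : nat -> R) : Prop :=
  [/\ polar A E',
      {ae Q, forall n, (0 < E' n)%R} &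
      forall E, polar A E -> expected_log Q (fun n => E n / E' n)%R <= 0].

(* [dP/dQ = 1/E'] for the numeraire [E'], as an identity of measures. *)
Definition is_RIPr (Q : probability nat R) (A : set (probability nat R))
    (P : {measure set nat -> \bar R}) : Prop :=
  exists2 E' : nat -> R, is_numeraire Q A E' &
    forall B : set nat, P B = \int[Q]_(n in B) ((E' n)^-1)%:E.

Lemma measurable_mass_gt0 (Q : probability nat R) :
  measurable [set n | (0 < mass Q n)%R].
Proof. by []. Qed.

(* The absolutely continuous part of Qt with respect to Q is the restriction of
   Qt to the atoms of Q; see [mass_ac_part] for its mass function. *)
Definition ac_part (Q Qt : probability nat R) : {measure set nat -> \bar R} :=
  mrestr Qt (measurable_mass_gt0 Q).

(* Division by 0 gives 0, in particular 0/0 = 0. *)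
Definition lcm_ratio (Q Qt : probability nat R) (n : nat) : R :=
  (mass Q n / mass Qt n)%R.

End definitions.

Arguments nonincreasing_class : clear implicits.

Section facts.
Local Open Scope ring_scope.
Context (R : realType).
Implicit Types (Q Qt : probability nat R) (G H : int -> R).

Lemma mass_ac_part Q Qt n :
  mass (ac_part Q Qt) n = if (0 < mass Q n)%R then mass Qt n else 0%R.
Proof.
rewrite /mass /ac_part /= /mrestr; case: ifPn => Qn.
  by rewrite setIidl // => _ ->.
rewrite (_ : _ `&` _ = set0) ?measure0 //.
by apply/seteqP; split=> // m [-> /=]; apply/negP.
Qed.

Lemma mass_fin Q n : Q [set n] = (mass Q n)%:E.
Proof. by rewrite /mass fineK // fin_num_measure. Qed.

Lemma cdfz_fin Q z : (cdfz Q z)%:E = Q [set n : nat | (n%:Z <= z)%R].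
Proof. by rewrite /cdfz fineK // fin_num_measure. Qed.

Lemma cdfz_ge0 Q z : (0 <= cdfz Q z)%R.
Proof. by rewrite fine_ge0. Qed.

Lemma cdfz_le1 Q z : (cdfz Q z <= 1)%R.
Proof. by rewrite -lee_fin cdfz_fin probability_le1. Qed.

Lemma cdfz_lt0 (P : {measure set nat -> \bar R}) z : (z < 0)%R -> cdfz P z = 0%R.
Proof.
move=> z0; rewrite /cdfz (_ : [set _ | _] = set0) ?measure0 //.
by apply/seteqP; split=> // n /=; lia.
Qed.

Lemma cdfz_cvg1 Q : cdfz Q n%:Z @[n --> \oo] --> (1 : R)%R.
Proof.
apply: fine_cvg; pose F n := [set k : nat | (k%:Z <= n%:Z)%R].
have -> : 1%:E = Q (\bigcup_n F n).
  rewrite -(@probability_setT _ _ _ Q); congr (Q _).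
  by apply/seteqP; split=> // n _; exists n => //; rewrite /F /=.
apply: nondecreasing_cvg_mu => //.
by move=> m n mn; apply/subsetPset => k; rewrite /F /=; lia.
Qed.

Lemma concave_nondecreasing H : concave_from_m1 H ->
  (forall z, (-1 <= z)%R -> (0 <= H z)%R) ->
  forall z, (-1 <= z)%R -> (H z <= H (z + 1))%R.
Proof.
move=> Hc H0 z z1; rewrite leNgt; apply/negP => lt.
pose d := (H z - H (z + 1))%R; have d0 : (0 < d)%R by rewrite subr_gt0.
have [k hk] : exists k : nat, (H (z + 1)%R / d < k%:R)%R.
  have z2 : -1 <= z + 1 by lia.
  exists (Num.bound (H (z + 1) / d)); apply: archi_boundP.
  by apply: divr_ge0; [exact: H0|exact: ltW].
rewrite ltr_pdivrMr // in hk.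
have w0 : (0 <= H (z + 1 + k%:Z))%R by apply: H0; lia.
have h1 : (z <= z + 1)%R by lia.
have h2 : (z + 1 <= z + 1 + k%:Z)%R by lia.
have := Hc _ _ _ z1 h1 h2.
have -> : (z + 1 + k%:Z - (z + 1) = k%:Z)%R by ring.
have -> : (z + 1 - z = 1)%R by ring.
have -> : (z + 1 + k%:Z - z = k%:Z + 1)%R by ring.
rewrite intrD -pmulrn /d in hk *.
nra.
Qed.

(* Hence the hypothesis [is_least_concave_majorant Q Qt] can always be met. *)
Lemma least_concave_majorant_exists Q :
  exists Qt, is_least_concave_majorant Q Qt.
Proof.
pose M := [set G | concave_from_m1 G /\ majorizes_from_m1 G (cdfz Q)].
pose H z := inf [set G z | G in M].
pose G1 (z : int) : R := if (z < 0)%R then 0%R else 1%R.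
have MG1 : M G1.
  split=> [a b c a1 ab bc|z z1]; rewrite /G1; last first.
    by case: ifPn => z0; [rewrite cdfz_lt0|rewrite cdfz_le1].
  have cb : (0 <= (c - b)%:~R :> R)%R by rewrite ler0z subr_ge0.
  have ba : (0 <= (b - a)%:~R :> R)%R by rewrite ler0z subr_ge0.
  have ca : ((c - a)%:~R = (c - b)%:~R + (b - a)%:~R :> R)%R.
    by rewrite -intrD; congr (_%:~R); ring.
  rewrite ca; case: (ltrP a 0) => a0; case: (ltrP b 0) => b0; case: (ltrP c 0) => c0; try lia; try lra.
  have -> : (b - a = 0)%R by lia.
  lra.
have lbH z : (-1 <= z)%R -> lbound [set G z | G in M] (cdfz Q z).
  by move=> z1 _ [G [_ GQ] <-]; exact: GQ.
have Hle G z : (-1 <= z)%R -> M G -> (H z <= G z)%R.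
  by move=> z1 MG; apply: ge_inf; [exists (cdfz Q z); exact: lbH|exists G].
have leH x z : (forall G, M G -> (x <= G z)%R) -> (x <= H z)%R.
  move=> xG; apply: lb_le_inf; first by exists (G1 z), G1.
  by move=> _ [G MG <-]; exact: xG.
have HQ z : (-1 <= z)%R -> (cdfz Q z <= H z)%R.
  by move=> z1; apply: leH => G [_]; exact.
have H1 z : (-1 <= z)%R -> (H z <= 1)%R.
  move=> z1; apply: (le_trans (Hle _ _ z1 MG1)).
  by rewrite /G1; case: ifP.
have Hm1 : H (-1)%R = 0%R.
  apply/le_anti/andP; split; first exact: (Hle G1).
  by rewrite -(@cdfz_lt0 Q (-1)) //; exact: HQ.
have Hc : concave_from_m1 H.
  move=> a b c a1 ab bc.
  have cb : (0 <= (c - b)%:~R :> R)%R by rewrite ler0z subr_ge0.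
  have ba : (0 <= (b - a)%:~R :> R)%R by rewrite ler0z subr_ge0.
  have [ac|ac] := eqVneq a c.
    have -> : b = c by lia.
    by rewrite ac !subrr !mul0r addr0.
  have ca : (0 < (c - a)%:~R :> R)%R by rewrite ltr0z; lia.
  rewrite -ler_pdivrMl //; apply: leH => G MG; rewrite ler_pdivrMl //.
  apply: le_trans (MG.1 _ _ _ a1 ab bc).
  by apply: lerD; apply: ler_wpM2l => //; apply: Hle => //; lia.
have Hnd z : (-1 <= z)%R -> (H z <= H (z + 1))%R.
  apply: concave_nondecreasing => // {}z z1.
  exact: le_trans (cdfz_ge0 Q z) (HQ _ z1).
pose p (n : nat) : R := (H n%:Z - H (n%:Z - 1))%R.
have p0 n : (0 <= p n)%R.
  by rewrite subr_ge0; have := Hnd (n%:Z - 1)%R; rewrite subrK; apply; lia.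
have psum n : (\sum_(0 <= k < n.+1) p k)%R = H n%:Z.
  elim: n => [|n IH]; first by rewrite big_nat1 /p sub0r Hm1 subr0.
  rewrite big_nat_recr //= IH /p (_ : n.+1%:Z - 1 = n%:Z)%R; last lia.
  by rewrite addrC subrK.
pose mu : {measure set nat -> \bar R} :=
  mseries (fun n => mscale (NngNum (p0 n)) (\d_n : {measure set nat -> \bar R})) 0.
have muE A : mu A = (\sum_(0 <= k <oo) ((p k)%:E * (\1_A k)%:E))%E.
  by rewrite /mu /= /mseries; apply: eq_eseriesr => k _; rewrite /mscale /= /dirac.
have muT : mu setT = 1%E.
  rewrite muE; apply/cvg_lim => //; rewrite -(cvg_shiftS _).
  under eq_fun => n.
    under eq_bigr => k _ do rewrite indicT mule1.
    rewrite sumEFin psum; over.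
  apply: cvg_EFin; first by apply: nearW.
  apply: (squeeze_cvgr _ (cdfz_cvg1 Q) (@cvg_cst _ _ _ _ _)).
  by apply: nearW => n; rewrite HQ ?H1; lia.
pose Qt : probability nat R := mnormalize mu Q.
have QtA A : Qt A = mu A.
  by rewrite /Qt /= /mnormalize muT onee_eq0 /= invr1 mule1.
have QtE z : (-1 <= z)%R -> cdfz Qt z = H z.
  case: z => [n _|[_|//]]; last by rewrite cdfz_lt0 // Hm1.
  rewrite /cdfz -psum QtA muE (@nneseries_split _ _ 0 n.+1); last first.
    by move=> k _; rewrite mule_ge0 // lee_fin.
  rewrite add0n eseries0 ?adde0; last first.
    move=> k nk _; rewrite indicE memNset ?mule0 //=; lia.
  rewrite (eq_big_nat _ _ (F2 := fun k => (p k)%:E)) ?sumEFin //.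
  by move=> k /andP[_ kn]; rewrite indicE mem_set ?mule1 //=; lia.
exists Qt; split=> [a b c a1 ab bc|z z1|G Gc GQ z z1].
- by rewrite !QtE; [exact: Hc|lia..].
- by rewrite QtE // HQ.
- by rewrite QtE // Hle.
Qed.

End facts.

(* Main.v *)
(* Write q, t for the mass functions of Q and its least concave majorant Qt.
   The CDF of Qt touches that of Q wherever t strictly decreases: otherwise it
   could be lowered at that point, down to the chord or to the CDF of Q. Hence
   summation by parts gives q(0)/t(0) + ... + q(k)/t(k) <= k + 1, and a second
   summation by parts, against a nonincreasing mass function, puts q/t in the
   polar. Since Qt is itself nonincreasing, the Q-expectation of E / (q/t) is
   at most the Qt-expectation of E, hence at most 1, and log x <= x - 1
   concludes. *)

Require Import Defs.
From HB Require Import structures.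
From mathcomp Require Import all_boot all_order all_algebra.
From mathcomp Require Import all_classical all_reals all_analysis.
From mathcomp Require Import measurable_realfun ring lra zify.

Set Implicit Arguments.
Unset Strict Implicit.
Unset Printing Implicit Defensive.

Import Order.TTheory GRing.Theory Num.Theory.
Import numFieldNormedType.Exports.

Local Open Scope classical_set_scope.
Local Open Scope ring_scope.

(** * Summation by parts with nonincreasing weights *)

Section partial_sums.
Context (R : realType).
Implicit Types p x : nat -> R.

(** The induction step lowers the weight [p n] to [p n.+1] in front of a nonpositive partial sum,
    which can only raise the product. *)
Lemma sum_nonincreasing_weight_le p x :
  (forall n, 0 <= p n) -> (forall n, p n.+1 <= p n) ->
  (forall n, \sum_(0 <= i < n.+1) x i <= 0) ->
  forall n, \sum_(0 <= i < n.+1) p i * x i <= p n * \sum_(0 <= i < n.+1) x i.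
Proof.
move=> p0 pS x0; elim=> [|n IH]; first by rewrite !big_nat1.
rewrite big_nat_recr //= [in leRHS]big_nat_recr //=.
by have := pS n; have := x0 n; nra.
Qed.

End partial_sums.

(** * Almost-everywhere comparison of integrals *)

Section integrals.
Context d (T : measurableType d) (R : realType) (mu : {measure set T -> \bar R}).
Local Open Scope ereal_scope.

(* No integrability is needed because [+oo - +oo = -oo]. *)
Lemma ae_le_integral_measurable (f g : T -> \bar R) :
  measurable_fun setT f -> measurable_fun setT g ->
  {ae mu, forall x, f x <= g x} -> \int[mu]_x f x <= \int[mu]_x g x.
Proof.
move=> mf mg fg; rewrite [leLHS]integralE [leRHS]integralE.
apply: leeB; apply: ae_ge0_le_integral => //.
- exact: measurable_funepos.
- exact: measurable_funepos.
- apply: filterS fg => x fgx _; rewrite !funeposE ge_max !le_max fgx.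
  by rewrite lexx orbT.
- exact: measurable_funeneg.
- exact: measurable_funeneg.
- apply: filterS fg => x fgx _; rewrite !funenegE ge_max !le_max.
  by rewrite leeN2 fgx lexx orbT.
Qed.

End integrals.

(** * Probabilities on [nat] through atoms and CDFs *)

Section measures_on_nat.
Context (R : realType).
Implicit Types (P Q : probability nat R).
Local Open Scope ereal_scope.

Lemma lne_le_subr1 (x : R) : (0 <= x)%R -> lne x%:E <= (x - 1)%:E.
Proof.
move=> x0; have := @le_lne1Dx R (x - 1)%:E.
by rewrite -EFinD addrCA subrr addr0 lee_fin; apply; lra.
Qed.

Lemma ge0_integral_nat P (f : nat -> \bar R) : (forall n, 0 <= f n) ->
  \int[P]_n f n = \sum_(0 <= n <oo) f n * (mass P n)%:E.
Proof.
move=> f0; rewrite -[setT](_ : \bigcup_n [set n] = setT); last first.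
  by apply/seteqP; split=> // n _; exists n.
rewrite ge0_integral_bigcup //; last by move=> i j _ _ [n [/= <- <-]].
apply: eq_eseriesr => n _.
rewrite -mass_fin -integral_cst //; apply: eq_integral => m.
by rewrite inE => ->.
Qed.

Lemma ae_nat Q (A : nat -> Prop) :
  (forall n, (0 < mass Q n)%R -> A n) -> {ae Q, forall n, A n}.
Proof.
move=> QA; apply/negligibleP => //.
(* The measure of the exceptional set becomes a series over atoms, whose terms all vanish. *)
rewrite -[LHS]mul1e -integral_cst // integral_mkcond ge0_integral_nat; last first.
  by move=> n; rewrite patchE; case: ifP.
apply: eseries0 => n _ _; rewrite patchE.
case: ifPn => [|_]; rewrite ?mul0e // inE => An; rewrite mul1e; congr _%:E.
apply/eqP; rewrite eq_le fine_ge0 // andbT leNgt; apply/negP => q0.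
exact: An (QA _ q0).
Qed.

Local Open Scope ring_scope.

Lemma mass_ge0 P n : 0 <= mass P n.
Proof. by rewrite fine_ge0. Qed.

Lemma massE P n : mass P n = cdfz P n%:Z - cdfz P (n%:Z - 1).
Proof.
apply/eqP; rewrite eq_sym subr_eq -eqe EFinD !cdfz_fin -mass_fin.
rewrite -measureU //; last first.
  by apply/seteqP; split=> // m [/= ->]; lia.
by apply/eqP; congr (P _); apply/seteqP; split=> [m /=|m [/= ->|/=]]; lia.
Qed.

Lemma massSE P n : mass P n.+1 = cdfz P (n%:Z + 1) - cdfz P n%:Z.
Proof. by rewrite massE; congr (cdfz P _ - cdfz P _); lia. Qed.

Lemma sum_mass P n : \sum_(0 <= i < n) mass P i = cdfz P (n%:Z - 1).
Proof.
elim: n => [|n IH]; first by rewrite big_nil cdfz_lt0.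
by rewrite big_nat_recr //= IH massE addrC subrK; congr cdfz; lia.
Qed.

End measures_on_nat.

(** * Concavity on {-1, 0, 1, ...} *)

Section concave_functions.
Context (R : realType).
Implicit Types G H : int -> R.

Lemma concave_min G H : concave_from_m1 G -> concave_from_m1 H ->
  concave_from_m1 (fun z => Num.min (G z) (H z)).
Proof.
move=> Gc Hc a b c a1 ab bc; rewrite [leRHS]minr_pMr ?ler0z; last lia.
have cb : (0 <= (c - b)%:~R :> R) by rewrite ler0z subr_ge0.
have ba : (0 <= (b - a)%:~R :> R) by rewrite ler0z subr_ge0.
rewrite le_min; apply/andP; split.
- apply: le_trans (Gc _ _ _ a1 ab bc).
  by apply: lerD; apply: ler_wpM2l; rewrite // ge_min lexx.
- apply: le_trans (Hc _ _ _ a1 ab bc).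
  by apply: lerD; apply: ler_wpM2l; rewrite // ge_min lexx orbT.
Qed.

Lemma concave_affine (u v : R) : concave_from_m1 (fun z => u + z%:~R * v).
Proof. by move=> a b c _ _ _; rewrite !intrB; lra. Qed.

Lemma concave_midpoint G (n : int) : concave_from_m1 G -> 0 <= n ->
  G (n - 1) + G (n + 1) <= 2 * G n.
Proof.
move=> Gc n0; have := Gc (n - 1) n (n + 1) ltac:(lia) ltac:(lia) ltac:(lia).
by rewrite !(intrD, intrB); lra.
Qed.

(** The line through the points at [n - 1] and [n + 1] dominates [G] except possibly strictly
    between them, that is, at [n]. *)
Lemma concave_le_chord G (n : int) : concave_from_m1 G -> 0 <= n ->
  forall z, -1 <= z -> z != n ->
  G z <= G (n - 1) + (z - n + 1)%:~R * ((G (n + 1) - G (n - 1)) / 2).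
Proof.
move=> Gc n0 z z1 zn; have [zn'|nz] := leP z (n - 1).
- have := Gc z (n - 1) (n + 1) z1 zn' ltac:(lia).
  by rewrite !(intrD, intrB); lra.
- have := Gc (n - 1) (n + 1) z ltac:(lia) ltac:(lia) ltac:(lia).
  by rewrite !(intrD, intrB); lra.
Qed.

End concave_functions.

(** * Contact points and support of the least concave majorant *)

Section least_concave_majorant.
Context (R : realType) (Q Qt : probability nat R).
Hypothesis QQt : is_least_concave_majorant Q Qt.

Let le_cdfz n : cdfz Q n%:Z <= cdfz Qt n%:Z.
Proof. by case: QQt => _ + _; apply; lia. Qed.

Lemma lcm_nonincreasing : nonincreasing_class R Qt.
Proof.
case: QQt => Tc _ _ n; rewrite massSE massE.
by have := concave_midpoint (n := n) Tc isT; lra.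
Qed.

Lemma lcm_contact n : mass Qt n.+1 < mass Qt n -> cdfz Q n%:Z = cdfz Qt n%:Z.
Proof.
rewrite massSE massE.
case: QQt => Tc TQ Tmin kink; apply/eqP; rewrite eq_le le_cdfz /=.
pose T := cdfz Qt; pose F := cdfz Q.
pose s := (T (n%:Z + 1) - T (n%:Z - 1)) / 2.
pose L z := T (n%:Z - 1) + (z - n%:Z + 1)%:~R * s.
(* The least nonnegative upward shift of the chord [L] that reaches [F] at [n]; the minimum of [T]
   and [L + e] is then a concave majorant of [F]. *)
pose e := Num.max 0 (F n%:Z - L n%:Z).
have e0 : 0 <= e by rewrite le_max lexx.
have TL z : -1 <= z -> z != n%:Z -> T z <= L z + e.
  by move=> z1 zn; rewrite -[T z]addr0 lerD // /L /s concave_le_chord.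
rewrite leNgt; apply/negP => FT.
(* At [n] the chord takes the mean of its end values, and the strict drop of the mass puts [T] above
   that mean. *)
have Ln : L n%:Z < T n%:Z.
  by rewrite /L /s subrr add0r mul1r; move: kink; rewrite -/T; lra.
have : T n%:Z <= Num.min (T n%:Z) (L n%:Z + e).
  apply: (Tmin (fun z => Num.min (T z) (L z + e))); last by lia.
  - apply: concave_min => //.
    have -> : (fun z => L z + e) =
        (fun z => T (n%:Z - 1) + (1 - n%:~R) * s + e + z%:~R * s).
      by apply/funext => z; rewrite /L !(intrD, intrB); ring.
    exact: concave_affine.
  - move=> z z1; rewrite le_min TQ //=; have [->|zn] := eqVneq z n%:Z.
      by rewrite -lerBlDl le_max lexx orbT.
    exact: le_trans (TQ _ z1) (TL _ z1 zn).
have -> : L n%:Z + e = Num.max (L n%:Z) (F n%:Z).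
  by rewrite /e addr_maxr addr0 addrC subrK.
by rewrite le_min le_max [_ <= L _]leNgt Ln /= [_ <= F _]leNgt FT /= andbF.
Qed.

(** A nonincreasing mass that vanishes at [n] vanishes from there on, so the CDF is constant from
    [n - 1] and equals its limit. *)
Lemma lcm_cdfz_eq1 n : mass Qt n = 0 -> cdfz Qt (n%:Z - 1) = 1.
Proof.
move=> tn0; have tm0 m : mass Qt (m + n)%N = 0.
  elim: m => // m IH; apply/eqP; rewrite eq_le mass_ge0 andbT -IH.
  exact: lcm_nonincreasing.
have Tm m : cdfz Qt (m + n)%N%:Z = cdfz Qt (n%:Z - 1).
  have Teq k : mass Qt k = 0 -> cdfz Qt k%:Z = cdfz Qt (k%:Z - 1).
    by rewrite massE => /eqP; rewrite subr_eq0 => /eqP.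
  elim: m => [|m <-]; first exact: Teq.
  by rewrite Teq ?tm0 //; congr cdfz; lia.
have /cvg_lim <- // := cdfz_cvg1 Qt.
by apply/esym/lim_near_cst => //; exists n => // m /= nm; rewrite -(subnK nm) Tm.
Qed.

(** Go back to the first zero of [mass Qt]. The mass drops strictly there, so the CDFs touch just
    before it, and that of [Q] has already reached 1. This zero is not at 0, as the CDF of [Qt] is 0
    at -1. *)
Lemma lcm_mass_eq0 n : mass Qt n = 0 -> mass Q n = 0.
Proof.
move=> tn0; have Fn1 : cdfz Q (n%:Z - 1) = 1.
  elim: n tn0 => [|n IH] tn0.
    by have /eqP := lcm_cdfz_eq1 tn0; rewrite cdfz_lt0 // eq_sym oner_eq0.
  rewrite (_ : n.+1%:Z - 1 = n%:Z :> int); last lia.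
  have [tn|tn] := eqVneq (mass Qt n) 0.
    apply/eqP; rewrite eq_le cdfz_le1 /= -(IH tn) -subr_ge0 -massE.
    exact: mass_ge0.
  rewrite lcm_contact; last by rewrite tn0 lt0r tn mass_ge0.
  by rewrite -(lcm_cdfz_eq1 tn0); congr cdfz; lia.
apply/eqP; rewrite eq_le mass_ge0 andbT massE Fn1 subr_le0.
exact: cdfz_le1.
Qed.

Lemma lcm_mass_gt0 n : 0 < mass Q n -> 0 < mass Qt n.
Proof.
move=> q0; rewrite lt0r mass_ge0 andbT; apply: contraTN q0 => /eqP tn0.
by rewrite lcm_mass_eq0 ?ltxx.
Qed.

(** * The ratio of masses belongs to the polar *)

Lemma lcm_ratio_ge0 n : 0 <= lcm_ratio Q Qt n.
Proof. by rewrite divr_ge0 ?mass_ge0. Qed.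

Lemma lcm_ratio_gt0 n : 0 < mass Q n -> 0 < lcm_ratio Q Qt n.
Proof. by move=> q0; rewrite divr_gt0 ?lcm_mass_gt0. Qed.

(* Summation by parts: [1 / mass Qt] only changes where [Q] and [Qt] have the
   same CDF. At [mass Qt k = 0] the bound reads [0] since [x / 0 = 0]. *)
Lemma sum_lcm_ratio_le k :
  \sum_(0 <= i < k.+1) (lcm_ratio Q Qt i - 1)
    <= (cdfz Q k%:Z - cdfz Qt k%:Z) / mass Qt k.
Proof.
elim: k => [|k IH].
  rewrite big_nat1 /lcm_ratio !massE !(@cdfz_lt0 _ _ (0%:Z - 1)) // !subr0 mulrBl.
  have [->|t0] := eqVneq (cdfz Qt 0%:Z) 0; first by rewrite invr0 !mulr0; lra.
  by rewrite divff.
rewrite big_nat_recr //= /lcm_ratio; have [->|tS0] := eqVneq (mass Qt k.+1) 0.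
  (* Here the new summand is -1, and the bound for [k] is nonpositive since [Qt] majorizes [Q]. *)
  rewrite invr0 !mulr0 sub0r; apply: le_trans (_ : _ <= 0 - 1) _; last by lra.
  rewrite lerD2r; apply: le_trans IH _.
  by rewrite mulr_le0_ge0 ?invr_ge0 ?mass_ge0 // subr_le0.
have -> : (cdfz Q k.+1%:Z - cdfz Qt k.+1%:Z) / mass Qt k.+1 =
    (cdfz Q k%:Z - cdfz Qt k%:Z) / mass Qt k.+1 + (mass Q k.+1 / mass Qt k.+1 - 1).
  rewrite -(divff tS0) -mulrBl -mulrDl; congr (_ / _).
  by rewrite !massSE (_ : k.+1%:Z = k%:Z + 1); [ring|lia].
rewrite lerD2r; apply: le_trans IH _.
have [tt|tt|->//] := ltgtP (mass Qt k.+1) (mass Qt k).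
- by rewrite lcm_contact // subrr !mul0r.
- by have := lcm_nonincreasing k; rewrite leNgt tt.
Qed.

Lemma polar_lcm_ratio : polar (nonincreasing_class R) (lcm_ratio Q Qt).
Proof.
split=> [n|]; first exact: lcm_ratio_ge0.
apply: ge_ereal_sup => _ [P PM <-]; rewrite ge0_integral_nat; last first.
  by move=> n; rewrite lee_fin lcm_ratio_ge0.
have r0 n : (0 <= (lcm_ratio Q Qt n)%:E * (mass P n)%:E)%E.
  by rewrite -EFinM lee_fin mulr_ge0 ?lcm_ratio_ge0 ?mass_ge0.
apply: lime_le; first by apply: is_cvg_nneseries => n _ _; exact: r0.
apply: nearW => -[|n]; first by rewrite big_nil lee_fin.
under eq_bigr do rewrite -EFinM.
rewrite sumEFin lee_fin.
apply: le_trans (_ : \sum_(0 <= i < n.+1) mass P i <= 1); last first.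
  by rewrite sum_mass cdfz_le1.
(* The difference of the two sums is the sum of [mass P i * (lcm_ratio Q Qt i - 1)], ready for
   summation by parts. *)
rewrite -subr_le0 -sumrB.
under eq_bigr do rewrite mulrC -[X in _ - X]mulr1 -mulrBr.
have S0 k : \sum_(0 <= i < k.+1) (lcm_ratio Q Qt i - 1) <= 0.
  apply: le_trans (sum_lcm_ratio_le k) _.
  by rewrite mulr_le0_ge0 ?invr_ge0 ?mass_ge0 // subr_le0.
apply: le_trans (sum_nonincreasing_weight_le (mass_ge0 P) PM S0 n) _.
by rewrite mulr_ge0_le0 ?mass_ge0.
Qed.

(** * The numeraire property and the projection *)

Lemma ac_part_lcmE (B : set nat) :
  (ac_part Q Qt B = \int[Q]_(n in B) ((lcm_ratio Q Qt n)^-1)%:E)%E.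
Proof.
rewrite /ac_part /= /mrestr -[LHS]mul1e -integral_cst // integral_mkcond.
rewrite [RHS]integral_mkcond !ge0_integral_nat; last 2 first.
- by move=> n; rewrite patchE; case: ifP => // _; rewrite lee_fin invr_ge0 lcm_ratio_ge0.
- by move=> n; rewrite patchE; case: ifP.
apply: eq_eseriesr => n _; rewrite !patchE in_setI.
case: (n \in B); rewrite ?mul0e //= (_ : (n \in _) = (0 < mass Q n)); last first.
  by apply/idP/idP; rewrite inE.
rewrite -EFinM /lcm_ratio; case: ifPn => q0.
  rewrite mul1e; congr _%:E; rewrite invf_div divfK //.
  by rewrite gt_eqF.
have -> : mass Q n = 0 by apply/eqP; rewrite eq_le mass_ge0 leNgt q0.
by rewrite mul0e mulr0.
Qed.

(** On atoms of [Q] the terms agree with those of the integral of [E] against [Qt]; elsewhere they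
    are 0. *)
Lemma integral_div_lcm_ratio_le E : polar (nonincreasing_class R) E ->
  (\int[Q]_n (E n / lcm_ratio Q Qt n)%:E <= 1)%E.
Proof.
move=> [E0 E1]; apply: le_trans (_ : _ <= \int[Qt]_n (E n)%:E)%E _; last first.
  apply: le_trans E1; apply: ereal_sup_ubound; exists Qt => //.
  exact: lcm_nonincreasing.
rewrite !ge0_integral_nat; last 2 first.
- by move=> n; rewrite lee_fin.
- by move=> n; rewrite lee_fin divr_ge0 ?lcm_ratio_ge0.
apply: lee_nneseries => [n _ _|n _].
  by rewrite -EFinM lee_fin mulr_ge0 ?divr_ge0 ?lcm_ratio_ge0 ?mass_ge0.
rewrite -!EFinM lee_fin -mulrA ler_wpM2l // /lcm_ratio invf_div.
have [->|q0] := eqVneq (mass Q n) 0; first by rewrite mulr0 mass_ge0.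
by rewrite divfK.
Qed.

Local Open Scope ereal_scope.

(** The upper bound for the log of [E n / lcm_ratio Q Qt n], integrable for [E] in the polar. *)
Let excess E n : \bar R := (E n / lcm_ratio Q Qt n - 1)%:E.

Let integrable_excess E : polar (nonincreasing_class R) E ->
  Q.-integrable setT (excess E) /\ \int[Q]_n excess E n <= 0.
Proof.
move=> EM; have Er1 := integral_div_lcm_ratio_le EM; have [E0 _] := EM.
have iEr : Q.-integrable setT (fun n => (E n / lcm_ratio Q Qt n)%:E).
  apply/integrableP; split=> //.
  rewrite (eq_integral (fun n => (E n / lcm_ratio Q Qt n)%:E)).
    exact: le_lt_trans Er1 (ltry _).
  by move=> n _; rewrite gee0_abs // lee_fin divr_ge0 ?lcm_ratio_ge0.
have i1 : Q.-integrable setT (cst 1 : nat -> \bar R).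
  exact: finite_measure_integrable_cst.
have -> : excess E = (fun n => (E n / lcm_ratio Q Qt n)%:E - cst 1 n) by [].
split; first exact: integrableB.
rewrite integralB // integral_cst // mul1e sube_le0.
by rewrite (_ : (Q : {measure set nat -> \bar R}) setT = 1) //; exact: probability_setT.
Qed.

Lemma is_numeraire_lcm_ratio :
  is_numeraire Q (nonincreasing_class R) (lcm_ratio Q Qt).
Proof.
split; [exact: polar_lcm_ratio|exact/ae_nat/lcm_ratio_gt0|move=> E EM].
have [_ EI] := integrable_excess EM; apply: le_trans EI.
apply: ae_le_integral_measurable => //.
apply: aeW => n; rewrite lne_le_subr1 // divr_ge0 ?lcm_ratio_ge0 //.
exact: EM.1.
Qed.

(** * Optimality for the expected logarithm *)

(** With [ln] instead of [lne] the values are finite everywhere, at the cost of a change on a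
    [Q]-null set. *)
Let logr n : \bar R := (ln (lcm_ratio Q Qt n))%:E.

Let expected_log_lcm_ratioE :
  expected_log Q (lcm_ratio Q Qt) = \int[Q]_n logr n.
Proof.
apply: ae_eq_integral => //.
by apply: ae_nat => n q0 _; rewrite lne_EFin // lcm_ratio_gt0.
Qed.

(* The negative part of [log (dQ/dQt^a)] is dominated by [dQt^a/dQ]. *)
Let logr_neg_lty : \int[Q]_n logr^\- n < +oo.
Proof.
apply: le_lt_trans (ltry 1).
apply: le_trans (_ : _ <= ac_part Q Qt setT) _; last first.
  by rewrite /ac_part /= /mrestr probability_le1.
rewrite ac_part_lcmE; apply: ae_le_integral_measurable => //.
apply: ae_nat => n q0; have r0 := lcm_ratio_gt0 q0.
rewrite funenegE ge_max -EFinN !lee_fin invr_ge0 (ltW r0) andbT -lnV //.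
have := lne_le_subr1 (ltW (_ : 0 < (lcm_ratio Q Qt n)^-1)%R).
rewrite invr_gt0 => /(_ r0); rewrite lne_EFin ?invr_gt0 // lee_fin.
by move/le_trans; apply; rewrite gerBl.
Qed.

(** The negative part of [logr] has finite integral. If the positive part does not, the right side
    is +oo; otherwise [logr] is integrable and the pointwise bound of log E by [logr + excess E] can
    be integrated. *)
Lemma expected_log_le_lcm_ratio E : polar (nonincreasing_class R) E ->
  expected_log Q E <= expected_log Q (lcm_ratio Q Qt).
Proof.
move=> EM; have [iE EI] := integrable_excess EM; rewrite expected_log_lcm_ratioE.
have [pos_oo|] := eqVneq (\int[Q]_n logr^\+ n) +oo.
  rewrite [leRHS]integralE pos_oo addye ?leey // eqe_oppLR.
  by rewrite lt_eqF.
rewrite -ltey => pos_fin.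
have ilog : Q.-integrable setT logr.
  apply/integrableP; split=> //.
  rewrite (_ : (fun n => `|logr n|) = (fun n => logr^\+ n + logr^\- n)); last first.
    exact: fune_abse.
  rewrite ge0_integralD //.
  exact: lte_add_pinfty.
apply: le_trans (_ : _ <= \int[Q]_n (logr n + excess E n)) _; last first.
  by rewrite integralD // geeDl.
apply: ae_le_integral_measurable => //.
apply: ae_nat => n q0; have r0 := lcm_ratio_gt0 q0.
have := EM.1 n; rewrite le_eqVlt => /predU1P[<-|E0].
  by rewrite le0_lneNy ?lexx // leNye.
rewrite lne_EFin // /logr /excess -EFinD lee_fin -lerBlDl -ln_div ?posrE //.
have Er0 := divr_gt0 E0 r0.
by have := lne_le_subr1 (ltW Er0); rewrite lne_EFin // lee_fin.
Qed.

End least_concave_majorant.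

Local Open Scope ereal_scope.

Theorem theorem3p12 (R : realType) (Q Qt : probability nat R)
    (hQt : is_least_concave_majorant Q Qt) :
  [/\ Q `<< Qt,
      is_RIPr Q (nonincreasing_class R) (ac_part Q Qt),
      polar (nonincreasing_class R) (lcm_ratio Q Qt) &
      ereal_sup [set expected_log Q E | E in polar (nonincreasing_class R)]
        = expected_log Q (lcm_ratio Q Qt)].
Proof.
split.
(* A [Qt]-null set contains no atom of [Q], since each such atom has positive [Qt]-mass. *)
- move=> A A0; apply: negligible_null_set; rewrite -[A]setCK.
  apply: (@ae_nat R Q (~` A)) => n q0 An; have := lcm_mass_gt0 hQt q0.
  by rewrite /mass A0 ?ltxx // => _ ->.
- exists (lcm_ratio Q Qt); first exact: is_numeraire_lcm_ratio.
  exact: ac_part_lcmE.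
- exact: polar_lcm_ratio.
- apply/eqP; rewrite eq_le; apply/andP; split.
    by apply: ge_ereal_sup => _ [E EM <-]; exact: expected_log_le_lcm_ratio.
  by apply: ereal_sup_ubound; exists (lcm_ratio Q Qt) => //; exact: polar_lcm_ratio.
Qed.
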